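(* There is a constant $c>0$ such that for every $n \ge 2$, every top-view caterpillar with $n$ vertices has a planar L-shaped drawing, respecting its prescribed cyclic edge orders, on any set of $c\, n \log n$ points in the plane in general orthogonal position.
   Context: A point set is in general orthogonal position if no two of its points share the same $x$-coordinate or the same $y$-coordinate. Points are unlabelled: the vertices are placed at distinct points of the set, with any vertex allowed at any point (not all points need be used). A planar L-shaped drawing is such a placement in which each edge is drawn as an orthogonal path consisting of one horizontal and one vertical segment (one bend), and no two edges intersect except at a common endpoint. A caterpillar is a tree such that deleting its leaves yields a path, the spine. The tree is ordered: at each vertex a cyclic order of incident edges is prescribed, and the drawing must realize these cyclic orders. A top-view caterpillar is an ordered caterpillar in which each spine vertex is adjacent to two leaves and these two leaves lie on opposite sides of the spine (i.e., in the prescribed cyclic order at each spine vertex the two leaf edges are separated by the spine edges). *)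

(* Defs.v *)
From HB Require Import structures.
From mathcomp Require Import all_boot all_order all_algebra.
From mathcomp Require Import reals Rstruct.
From Stdlib Require Rdefinitions Rpower.
Set Implicit Arguments. Unset Strict Implicit. Unset Printing Implicit Defensive.
Import Order.TTheory GRing.Theory Num.Theory.
Local Open Scope ring_scope.

Notation R := Rdefinitions.R.
Notation ln := Rpower.ln.

Definition pt := (R * R)%type.

Definition general_orthogonal (P : seq pt) : Prop :=
  uniq P /\ {in P &, forall p q, p != q -> p.1 != q.1 /\ p.2 != q.2}.

Definition on_seg (a b p : pt) : Prop :=
  exists t : R, 0 <= t <= 1 /\
    p = ((1 - t) * a.1 + t * b.1, (1 - t) * a.2 + t * b.2).

Section Graphs.
Variable V : finType.

Definition simple_graph (adj : rel V) : Prop := symmetric adj /\ irreflexive adj.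

Definition deg (adj : rel V) (v : V) : nat := #|[set w | adj v w]|.

(** A tree: connected simple graph with |V| - 1 edges
    (the edge count is doubled since ordered pairs are counted). *)
Definition is_tree (adj : rel V) : Prop :=
  [/\ simple_graph adj, (forall x y, connect adj x y) &
      #|[set e : V * V | adj e.1 e.2]| = (2 * (#|V| - 1))%N].

Definition leaf (adj : rel V) (v : V) : bool := deg adj v == 1%N.
Definition spine_vertex (adj : rel V) (v : V) : bool := ~~ leaf adj v.

Definition caterpillar (adj : rel V) : Prop :=
  is_tree adj /\
  exists s : seq V, [/\ uniq s, (forall v, (v \in s) = spine_vertex adj v) &
                        sorted adj s].

(** An ordering (rotation system): at each vertex, a cyclic order (a list
    considered up to rotation) of its neighbours, i.e. of its incident edges. *)
Definition rotation_system (adj : rel V) (rho : V -> seq V) : Prop :=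
  forall v, uniq (rho v) /\ (forall w, (w \in rho v) = adj v w).

(** In the cyclic order r, the elements a and b are separated by elements
    satisfying Q: both open arcs of the cycle between a and b contain an
    element satisfying Q. *)
Definition separated (r : seq V) (Q : pred V) (a b : V) : bool :=
  let r' := rot (index a r) r in
  let j := index b r' in
  has Q (drop 1 (take j r')) && has Q (drop j.+1 r').

(** Top-view caterpillar: ordered caterpillar in which every spine vertex is
    adjacent to exactly two leaves, lying on opposite sides of the spine: the
    two leaf edges are separated by the spine edges in the cyclic order.  At a
    spine vertex with fewer than two spine neighbours (end of the spine) this
    side condition is vacuous (any cyclic order of the incident edges puts the
    two leaves on opposite sides of the spine). *)
Definition top_view_caterpillar (adj : rel V) (rho : V -> seq V) : Prop :=
  [/\ caterpillar adj, rotation_system adj rho &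
      forall v, spine_vertex adj v ->
        #|[set w | adj v w & leaf adj w]| = 2%N /\
        (#|[set w | adj v w & spine_vertex adj w]| = 2%N ->
          forall l1 l2, l1 != l2 -> adj v l1 -> leaf adj l1 ->
            adj v l2 -> leaf adj l2 ->
            separated (rho v) (spine_vertex adj) l1 l2)].

(** L-shaped placement: vertex v is placed at f v (injectively, on points of P);
    edge uv is drawn as the polyline f u -- cr u v -- f v, with bend cr u v
    (= cr v u) equal to (x(u), y(v)) or (x(v), y(u)). *)
Definition L_placement (adj : rel V) (P : seq pt) (f : V -> pt)
    (cr : V -> V -> pt) : Prop :=
  [/\ injective f, (forall v, f v \in P) &
      forall u v, adj u v ->
        cr u v = cr v u /\
        (cr u v = ((f u).1, (f v).2) \/ cr u v = ((f v).1, (f u).2))].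

Definition on_edge (f : V -> pt) (cr : V -> V -> pt) (u v : V) (p : pt) : Prop :=
  on_seg (f u) (cr u v) p \/ on_seg (cr u v) (f v) p.

Definition planar_drawing (adj : rel V) (f : V -> pt) (cr : V -> V -> pt) : Prop :=
  forall u v u' v', adj u v -> adj u' v' -> [set u; v] != [set u'; v'] ->
    forall p, on_edge f cr u v p -> on_edge f cr u' v' p ->
      exists w, [/\ (w == u) || (w == v), (w == u') || (w == v') & p = f w].

(** Direction in which edge uv leaves u (first segment f u -- cr u v):
    0 = right, 1 = up, 2 = left, 3 = down (counterclockwise order). *)
Definition dir (f : V -> pt) (cr : V -> V -> pt) (u v : V) : nat :=
  let c := cr u v in
  if (f u).1 < c.1 then 0%N
  else if (f u).2 < c.2 then 1%N
  else if c.1 < (f u).1 then 2%N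
  else 3%N.

Definition realizes_rotation (rho : V -> seq V) (f : V -> pt)
    (cr : V -> V -> pt) : Prop :=
  forall v, exists i, sorted (fun a b => (dir f cr v a < dir f cr v b)%N)
                             (rot i (rho v)).

Definition planar_L_drawing (adj : rel V) (rho : V -> seq V) (P : seq pt) : Prop :=
  exists (f : V -> pt) (cr : V -> V -> pt),
    [/\ L_placement adj P f cr, planar_drawing adj f cr &
        realizes_rotation rho f cr].

End Graphs.

(* Main.v *)
Require Import Defs.
From HB Require Import structures.
From mathcomp Require Import all_boot all_order all_algebra.
From mathcomp Require Import reals Rstruct.
From mathcomp Require Import zify lra.
Import Order.TTheory GRing.Theory Num.Theory.
Set Implicit Arguments. Unset Strict Implicit. Unset Printing Implicit Defensive.
Local Open Scope ring_scope.

(** Linearly many points already suffice. Sorted by abscissa, the points are cut into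
    triples; the point of median ordinate of a triple can be drawn as a spine vertex with
    horizontal spine edges, the two other points being its upper and lower leaf.
    A spine vertex with vertical spine edges fits between two such medians [p] and [r]
    as soon as medians [a], [q], [b] lie between them in abscissa and [p, a, q, b, r] is
    monotone in ordinate: [q] carries the leaves [a] and [b], and the edges
    run from [p] through [q] to [r] without crossings. Among 17 medians some two are linked
    in this way (Erdos and Szekeres), so the link relation has antichains of size at most 16
    and therefore a path of length [n] on [16 n + 1] medians. The spine is drawn along
    this path with horizontal and vertical spine vertices alternating. *)

(** * Long paths in relations without large antichains *)

Section LongPaths.
Variable T : eqType.
Implicit Types (e : rel T) (s t p : seq T).

(* The sources of e on s form an antichain, and every other element extends
   a path to the left. *)
Lemma path_or_antichain e m k s : uniq s -> (m * k < size s)%N ->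
  (exists x p, [/\ {subset x :: p <= s}, path e x p & size p = m]) \/
  (exists t, [/\ uniq t, {subset t <= s}, size t = k.+1 &
                 {in t &, forall x y, ~~ e x y}]).
Proof.
elim: m s => [|m IHm] s us ms.
  by case: s us ms => // x s _ _; left; exists x, [::]; split=> // y; rewrite !inE => ->.
pose src x := ~~ has (fun z => e z x) s.
have [large|small] := ltnP k (size (filter src s)).
  have sub x : x \in take k.+1 (filter src s) -> src x && (x \in s).
    by move/mem_take; rewrite mem_filter.
  right; exists (take k.+1 (filter src s)); split.
  - by rewrite take_uniq ?filter_uniq.
  - by move=> x /sub /andP[].
  - by rewrite size_takel.
  - move=> x y /sub /andP[_ sx] /sub /andP[/hasPn ey _].
    exact: ey.
have szs : (m * k < size (filter (predC src) s))%N.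
  have := count_predC src s; rewrite -!size_filter; nia.
have [[x [p [xps xp szp]]]|[t [ut ts szt te]]] := IHm _ (filter_uniq _ us) szs.
  have := xps x (mem_head _ _); rewrite mem_filter /= negbK => /andP[/hasP[z zs ezx] _].
  left; exists z, (x :: p); split=> /=; rewrite ?ezx ?szp //.
  move=> y; rewrite inE => /predU1P[-> //|/xps].
  by rewrite mem_filter => /andP[].
by right; exists t; split=> // y /ts; rewrite mem_filter => /andP[].
Qed.

End LongPaths.

(** * Links between medians along monotone sequences of five ordinates *)

Section Monotone.
Variable Y : nat -> R.

Definition inc : rel nat := [rel i j | (i < j)%N && (Y i < Y j)].
Definition dec : rel nat := [rel i j | (i < j)%N && (Y j < Y i)].
Definition monopath i s := path inc i s || path dec i s.

(** The witnesses range over an explicit finite list, which keeps the relation boolean and lets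
    [link] recover them by search. *)
Definition linked (N : nat) : rel nat := [rel i j |
  has (fun t => monopath i [:: t.1; t.2.1; t.2.2; j])
    [seq (a, qb) | a <- iota 0 N, qb <- [seq (q, b) | q <- iota 0 N, b <- iota 0 N]]].

Definition link N i j : nat * (nat * nat) :=
  let T := [seq (a, qb) | a <- iota 0 N, qb <- [seq (q, b) | q <- iota 0 N, b <- iota 0 N]] in
  nth (0, (0, 0))%N T (find (fun t => monopath i [:: t.1; t.2.1; t.2.2; j]) T).

Lemma linkP N i j : linked N i j ->
  monopath i [:: (link N i j).1; (link N i j).2.1; (link N i j).2.2; j].
Proof. by rewrite /linked /link /=; apply: nth_find. Qed.

Lemma link_lt N i j : linked N i j ->
  [/\ (i < (link N i j).1)%N, ((link N i j).1 < (link N i j).2.1)%N,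
   ((link N i j).2.1 < (link N i j).2.2)%N & ((link N i j).2.2 < j)%N].
Proof.
by move/linkP; rewrite /monopath /= !andbT => /orP[] /and4P[] /andP[-> _]
  /andP[-> _] /andP[-> _] /andP[-> _].
Qed.

Lemma mono5_linked N (s : seq nat) x p : {subset s <= iota 0 N} -> {subset x :: p <= s} ->
  size p = 4 -> monopath x p -> exists i j, [/\ i \in s, j \in s & linked N i j].
Proof.
move=> sN; case: p => [|a [|q [|b [|j []]]]] // sub _ mono.
have ms y : y \in [:: x; a; q; b; j] -> y \in s by apply: sub.
exists x, j; split; try by apply: ms; rewrite !inE eqxx ?orbT.
apply/hasP; exists (a, (q, b)) => //.
by apply/allpairsP; exists (a, (q, b)); split=> //=; last (apply/allpairsP; exists (q, b); split=> //=);
  apply: sN; apply: ms; rewrite !inE eqxx ?orbT.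
Qed.

(* Erdos and Szekeres: an antichain of [inc] listed in increasing order is a [dec] path. *)
Lemma linked_pair N (s : seq nat) : uniq s -> {subset s <= iota 0 N} -> size s = 17%N ->
  {in s &, injective Y} -> exists i j, [/\ i \in s, j \in s & linked N i j].
Proof.
move=> us sN szs Yinj.
have lt44 : (4 * 4 < size s)%N by rewrite szs.
have [[x [p [xps xp szp]]]|[t [ut ts szt te]]] := path_or_antichain inc us lt44.
  by apply: (@mono5_linked N s x p) => //; rewrite /monopath xp.
have : sorted ltn (sort leq t) by rewrite ltn_sorted_uniq_leq sort_uniq ut sort_sorted //; exact: leq_total.
have := size_sort leq t; have := mem_sort leq t.
case: (sort leq t) => [|x p] mt szst st; first by rewrite szt in szst.
have xpt : {subset x :: p <= t} by move=> y; rewrite -mt.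
apply: (@mono5_linked N s x p) => //; first by move=> y /xpt /ts.
  by move: szst; rewrite szt /= => -[].
apply/orP; right; apply: (@sub_in_path _ (mem t) ltn) st; last by apply/allP.
move=> i j it jt /= ij; apply/andP; split=> //.
have := te i j it jt; rewrite /inc /= (ij : (i < j)%N) /= -leNgt le_eqVlt => /predU1P[/Yinj E|//].
by move: ij; rewrite E ?ts // /ltn /= ltnn.
Qed.

(** An antichain of 17 indices would contradict [linked_pair], so only the long path remains. *)
Lemma linked_path N m : {in iota 0 N &, injective Y} -> (m * 16 < N)%N ->
  exists x p, [/\ {subset x :: p <= iota 0 N}, path (linked N) x p & size p = m].
Proof.
move=> Yinj mN.
have szN : (m * 16 < size (iota 0 N))%N by rewrite size_iota.
have [//|[t [ut tN szt te]]] :=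
  path_or_antichain (linked N) (iota_uniq 0 N) szN.
have Yt : {in t &, injective Y} by move=> i j /tN iN /tN jN; apply: Yinj.
have [i [j [it jt]]] := linked_pair ut tN szt Yt.
by rewrite (negPf (te i j it jt)).
Qed.

End Monotone.

(* [F i r] is the point of spine vertex number [i] if [r = 0], and of its leaves
   for [r = 1, 2]. Spine edges leave even spine vertices horizontally and odd
   ones vertically. *)
Definition rising (F : nat -> nat -> pt) i :=
  [/\ (F i.-1 0%N).2 < (F i 1%N).2 < (F i.+1 0%N).2, (F i.-1 0%N).2 < (F i 0%N).2 < (F i.+1 0%N).2,
      (F i.-1 0%N).2 < (F i 2%N).2 < (F i.+1 0%N).2 & (F i 1%N).1 < (F i 0%N).1 < (F i 2%N).1].

(** The leaves change sides compared with [rising]: the vertical order of the neighbours is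
    reversed, and the cyclic order next, leaf 1, previous, leaf 2 has to stay counterclockwise. *)
Definition falling (F : nat -> nat -> pt) i :=
  [/\ (F i.+1 0%N).2 < (F i 1%N).2 < (F i.-1 0%N).2, (F i.+1 0%N).2 < (F i 0%N).2 < (F i.-1 0%N).2,
      (F i.+1 0%N).2 < (F i 2%N).2 < (F i.-1 0%N).2 & (F i 2%N).1 < (F i 0%N).1 < (F i 1%N).1].

Definition layout n (F : nat -> nat -> pt) :=
  [/\ forall i r r', (i <= n)%N -> (F i r).1 < (F i.+1 r').1,
      forall i, (i <= n)%N -> ~~ odd i -> (F i 2%N).2 < (F i 0%N).2 < (F i 1%N).2 &
      forall i, (i <= n)%N -> odd i -> rising F i \/ falling F i].

(** * Extracting a layout from points in general orthogonal position *)

Section Triples.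
Variable P : seq pt.
Hypothesis gP : general_orthogonal P.

Lemma abscissa_inj : {in P &, injective fst}.
Proof.
case: gP => _ g p q pP qP E; have [//|/(g p q pP qP)[+ _]] := eqVneq p q.
by rewrite E eqxx.
Qed.

Lemma ordinate_inj : {in P &, injective snd}.
Proof.
case: gP => _ g p q pP qP E; have [//|/(g p q pP qP)[_]] := eqVneq p q.
by rewrite E eqxx.
Qed.

Definition by_x := sort (fun p q => p.1 <= q.1) P.
Definition xpt k : pt := nth (0, 0) by_x k.
Definition triple j := sort (fun p q : pt => q.2 <= p.2) [seq xpt k | k <- iota (3 * j) 3].
(** Triples are sorted from top to bottom, so [r = 0] selects the median and [r = 1] the top point.
    The default 2 sends every other [r] to the bottom point, so that no index leaves the triple. *)
Definition tpt j r : pt := nth (0, 0) (triple j) (nth 2 [:: 1; 0] r)%N.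

Lemma xpt_in k : (k < size P)%N -> xpt k \in P.
Proof. by move=> kP; rewrite -(mem_sort (fun p q => p.1 <= q.1)) mem_nth ?size_sort. Qed.

Lemma xpt_inj k l : (k < size P)%N -> (l < size P)%N -> xpt k = xpt l -> k = l.
Proof.
move=> kP lP /eqP; rewrite nth_uniq ?size_sort // => [/eqP //|].
by rewrite sort_uniq; case: gP.
Qed.

Lemma xpt_lt k l : (k < l)%N -> (l < size P)%N -> (xpt k).1 < (xpt l).1.
Proof.
move=> kl lP; have kP := ltn_trans kl lP.
rewrite lt_neqAle; apply/andP; split.
  by apply/eqP => /abscissa_inj E; move: kl; rewrite (@xpt_inj k l) ?ltnn // E ?xpt_in.
apply: (@sorted_leq_nth _ (fun p q : pt => p.1 <= q.1)) => //=.
- by move=> x y z; apply: le_trans.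
- by apply: sort_sorted => x y; apply: le_total.
- by rewrite inE size_sort.
- by rewrite inE size_sort.
- exact: ltnW.
Qed.

Lemma tpt_in j r : tpt j r \in [seq xpt k | k <- iota (3 * j) 3].
Proof.
rewrite -(mem_sort (fun p q : pt => q.2 <= p.2)) mem_nth // size_sort size_map size_iota.
by case: r => [|[|[|[]]]].
Qed.

Lemma tptP j r : exists2 k, (3 * j <= k < 3 * j + 3)%N & tpt j r = xpt k.
Proof. by have /mapP[k] := tpt_in j r; rewrite mem_iota; exists k. Qed.

Lemma tpt_inP j r : (3 * j + 2 < size P)%N -> tpt j r \in P.
Proof. by move=> jP; have [k kj ->] := tptP j r; apply: xpt_in; lia. Qed.

Lemma tpt_lt i j r r' : (i < j)%N -> (3 * j + 2 < size P)%N ->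
  (tpt i r).1 < (tpt j r').1.
Proof.
move=> ij jP; have [k kj ->] := tptP i r; have [l lj ->] := tptP j r'.
by apply: xpt_lt; lia.
Qed.

Lemma tpt_vertical j : (3 * j + 2 < size P)%N ->
  (tpt j 2%N).2 < (tpt j 0%N).2 < (tpt j 1%N).2.
Proof.
move=> jP.
have szt : size (triple j) = 3%N by rewrite size_sort size_map size_iota.
have tP : {subset triple j <= P}.
  move=> p; rewrite mem_sort => /mapP[k]; rewrite mem_iota => kj ->; apply: xpt_in; lia.
have ut : uniq (triple j).
  rewrite sort_uniq map_inj_in_uniq ?iota_uniq // => k l; rewrite !mem_iota => kj lj.
  by apply: xpt_inj; lia.
have st : sorted (fun p q : pt => q.2 <= p.2) (triple j).
  by apply: sort_sorted => x y; apply: le_total.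
have lt k : (k < 2)%N -> (nth (0, 0) (triple j) k.+1).2 < (nth (0, 0) (triple j) k).2.
  move=> k2; rewrite lt_neqAle; apply/andP; split.
    apply/eqP => /ordinate_inj E.
    have /eqP : nth (0, 0) (triple j) k.+1 = nth (0, 0) (triple j) k.
      by apply: E; apply/tP/mem_nth; rewrite szt; lia.
    by rewrite nth_uniq ?szt //; lia.
  by have /(sortedP (0, 0)) := st; apply; rewrite szt.
by rewrite /tpt /= !lt.
Qed.

Lemma tpt_ordinate_inj N : (3 * N <= size P)%N ->
  {in iota 0 N &, injective (fun j => (tpt j 0%N).2)}.
Proof.
move=> NP i j; rewrite !mem_iota /= add0n => iN jN /ordinate_inj E.
have {}E : tpt i 0 = tpt j 0 by apply: E; apply: tpt_inP; lia.
case: (ltngtP i j) => // ij.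
  by have := @tpt_lt i j 0 0 ij ltac:(lia); rewrite E ltxx.
by have := @tpt_lt j i 0 0 ij ltac:(lia); rewrite E ltxx.
Qed.

Lemma layout_exists n : (0 < n)%N -> (3 * (n * 16 + 1) <= size P)%N ->
  exists2 F, layout n F & forall i r, (i <= n)%N -> F i r \in P.
Proof.
move=> n0; set N := (n * 16 + 1)%N => NP.
have nN : (n * 16 < N)%N by rewrite /N addn1.
set Y := fun j => (tpt j 0%N).2.
have [x [p [xpN xp szp]]] := linked_path (tpt_ordinate_inj NP) nN.
pose h i := nth 0%N (x :: p) i.
have hN i : (i <= n)%N -> (h i < N)%N.
  by move=> iN; have := xpN (h i); rewrite mem_iota add0n; apply; rewrite mem_nth //= szp.
have hl i : (i < n)%N -> linked Y N (h i) (h i.+1).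
  by move=> iN; move/(pathP 0%N): xp => /(_ i); rewrite szp => /(_ iN).
pose L i := link Y N (h i) (h i.+1).
(* Even nodes use a whole triple, odd nodes the medians of the three triples that witness a link.
   The comparison with [up] makes the left witness leaf 1 on a rising link and leaf 2 on a falling
   one. *)
pose F i r : pt := if odd i then
    let up := Y (h i./2) < Y (h i./2.+1) in
    let t := L i./2 in
    if r == 0%N then tpt t.2.1 0 else if (r == 1%N) == up then tpt t.1 0 else tpt t.2.2 0
  else tpt (h i./2) r.
have tP j : (j < N)%N -> (3 * j + 2 < size P)%N by lia.
(* Successive nodes draw from triples of increasing index, which separates them in abscissa. Node
   [n.+1] is included because the layout compares node [n] with it. *)
have Fin i r : (i <= n.+1)%N -> exists j r', [/\ (j < N)%N, F i r = tpt j r' &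
   if odd i then (h i./2 < j < h i./2.+1)%N else j == h i./2].
  move=> iN; rewrite /F; case: ifP => oi; last first.
    by exists (h i./2), r; split=> //; apply: hN; lia.
  have i2n : (i./2 < n)%N by lia.
  have [] := link_lt (hl _ i2n); rewrite -/(L i./2) => l1 l2 l3 l4.
  have hN' : (h i./2.+1 < N)%N by apply: hN.
  case: ifP => _; last case: ifP => _.
  - by exists (L i./2).2.1, 0%N; split => //; lia.
  - by exists (L i./2).1, 0%N; split => //; lia.
  - by exists (L i./2).2.2, 0%N; split => //; lia.
exists F; last by move=> i r /leqW /(Fin i r)[j [r' [jN -> _]]]; apply/tpt_inP/tP.
split.
- move=> i r r' iN.
  have [j [s [jN -> jE]]] := Fin i r (leqW iN).
  have [k [s' [kN -> kE]]] := Fin i.+1 r' iN.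
  by apply: tpt_lt; [move: jE kE; rewrite /= uphalf_half; case: (odd i); rewrite ?add1n ?add0n /=; lia|exact: tP].
- by move=> i iN oi; rewrite /F (negPf oi); apply/tpt_vertical/tP/hN; lia.
- move=> i iN oi.
  have i2n : (i./2 < n)%N by lia.
  have oi1 : odd i.-1 = false by lia.
  have oi2 : odd i.+1 = false by lia.
  have ei1 : i.-1./2 = i./2 by lia.
  have ei2 : i.+1./2 = i./2.+1 by lia.
  have hN' : (h i./2.+1 < N)%N by apply: hN.
  rewrite /rising /falling /F oi oi1 oi2 ei1 ei2 /=.
  have [] := link_lt (hl _ i2n); rewrite -/(L i./2) => l1 l2 l3 l4.
  have x1 : (tpt (L i./2).1 0%N).1 < (tpt (L i./2).2.1 0%N).1 by apply: tpt_lt => //; apply: tP; lia.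
  have x2 : (tpt (L i./2).2.1 0%N).1 < (tpt (L i./2).2.2 0%N).1 by apply: tpt_lt => //; apply: tP; lia.
  have := linkP (hl _ i2n); rewrite -/(L i./2) /monopath /= !andbT.
  rewrite {1 4 5 8}/Y => /orP[] /and4P[] /andP[_ y1] /andP[_ y2] /andP[_ y3] /andP[_ y4].
  - left; have -> : Y (h i./2) < Y (h i./2.+1) by rewrite /Y; lra.
    by split; lra.
  - right; have -> : Y (h i./2) < Y (h i./2.+1) = false by rewrite /Y; lra.
    by split; lra.
Qed.

End Triples.

(** * Edges described by linear inequalities *)

Definition between (a b x : R) := (a <= x <= b) || (b <= x <= a).

(* The points of an edge that is horizontal at [a] and vertical at [b]. *)
Definition on_L (a b p : pt) :=
  (p.2 == a.2) && between a.1 b.1 p.1 || (p.1 == b.1) && between a.2 b.2 p.2.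

(** Passing to the bounding box loses nothing for axis-parallel segments and leaves planarity to
    linear arithmetic. *)
Lemma on_seg_between a b p : on_seg a b p -> between a.1 b.1 p.1 && between a.2 b.2 p.2.
Proof.
have conv u v t : 0 <= t <= 1 -> between u v ((1 - t) * u + t * v).
  by move=> t01; apply/orP; case: (leP u v) => uv; [left|right]; nra.
by move=> [t [t01 ->]]; rewrite !conv.
Qed.

Lemma on_L_horizontal a b p : on_seg a (b.1, a.2) p -> on_L a b p.
Proof.
move=> /on_seg_between /= /andP[px py]; apply/orP; left; rewrite px andbT.
by move: py; rewrite /between => py; apply/eqP; lra.
Qed.

Lemma on_L_vertical a b p : on_seg (b.1, a.2) b p -> on_L a b p.
Proof.
move=> /on_seg_between /= /andP[px py]; apply/orP; right; rewrite py andbT.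
by move: px; rewrite /between => px; apply/eqP; lra.
Qed.

Lemma on_segC a b p : on_seg a b p -> on_seg b a p.
Proof.
by move=> [t [t01 ->]]; exists (1 - t); split; [lra|congr pair; lra].
Qed.

(* Edge [k] of spine vertex [i] leads to the next spine vertex for [k = 0] and
   to leaf [k] otherwise. *)
Definition far_end i k : nat * nat := if k == 0%N then (i.+1, 0%N) else (i, k).

Definition pos (F : nat -> nat -> pt) (u : nat * nat) := F u.1 u.2.

(** The test decides whether the edge is vertical at spine node [i]: spine edges are so at odd
    nodes, leaf edges at even ones. *)
Definition on_model F i k p :=
  if odd i (+) (k != 0%N) then on_L (pos F (far_end i k)) (F i 0%N) p
  else on_L (F i 0%N) (pos F (far_end i k)) p.

(** * Planarity of the model drawing *)

Section Layout.
Variables (n : nat) (F : nat -> nat -> pt).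
Hypothesis lF : layout n F.

Lemma layout_x i r r' : (i <= n)%N -> (F i r).1 < (F i.+1 r').1.
Proof. by case: lF => + _ _; apply. Qed.

Lemma layout_ltx i j r r' : (i < j)%N -> (j <= n.+1)%N -> (F i r).1 < (F j r').1.
Proof.
elim: j r' => // j IHj r'; rewrite ltnS leq_eqVlt ltnS => /predU1P[->|ij] jn.
  exact: layout_x.
by apply: lt_trans (layout_x 0 _ jn); apply: IHj => //; apply: leqW.
Qed.

(** This bound and the next two confine the edges of a node to a vertical strip, so that only edges
    of equal or consecutive nodes can meet. *)
Lemma on_model_le i k p : (i <= n)%N -> on_model F i k p -> p.1 <= (F i.+1 0%N).1.
Proof.
move=> iN; have := layout_x 0 0 iN; have := layout_x k 0 iN.
rewrite /on_model /pos /far_end /on_L /between; case: (k == 0%N) => /=; case: ifP => _; lra.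
Qed.

Lemma on_leaf_lt i k p r : (i <= n)%N -> (k != 0)%N -> on_model F i k p ->
  p.1 < (F i.+1 r).1.
Proof.
move=> iN k0; have := layout_x 0 r iN; have := layout_x k r iN.
rewrite /on_model /pos /far_end /on_L /between (negPf k0) /=; case: ifP => _; lra.
Qed.

Lemma on_model_gt i k p r : (i < n)%N -> on_model F i.+1 k p -> (F i r).1 < p.1.
Proof.
move=> iN; have := layout_x r 0 (ltnW iN); have := layout_x r k (ltnW iN).
have := layout_x 0 0 iN.
rewrite /on_model /pos /far_end /on_L /between; case: (k == 0%N) => /=; case: ifP => _; lra.
Qed.

Lemma layout_star i : (i <= n)%N -> (if odd i then rising F i \/ falling F i
  else (F i 2%N).2 < (F i 0%N).2 < (F i 1%N).2 : Prop).
Proof.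
by case: lF => _ lh lv iN; case: ifP => oi; [apply: lv|apply: lh; rewrite ?oi].
Qed.

Lemma pt_eq (p q : pt) : (p.1 == q.1) && (p.2 == q.2) -> p = q.
Proof. by case: p q => a b [c d] /andP[/eqP /= -> /eqP ->]. Qed.

(** At an odd node all ordinates lie strictly between those of the two neighbouring spine nodes, so
    leaf edges miss the horizontal parts of the spine edges. At an even node the two leaves lie
    strictly on either side of the horizontal line that carries the spine edges. *)
Lemma out_edges_planar i k k' p : (i <= n)%N -> (k < k')%N -> (k' < 3)%N ->
  on_model F i k p -> on_model F i k' p -> p = F i 0%N.
Proof.
move=> iN kk k3 e e'; apply: pt_eq; move: e e'.
have := layout_star iN; have := layout_x 0 0 iN.
have := layout_x 1 0 iN; have := layout_x 2 0 iN.
have {kk k3}: (k == 0%N) && (k' == 1%N) || (k == 0%N) && (k' == 2%N) || (k == 1%N) && (k' == 2%N) by lia.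
rewrite /on_model /pos /far_end /on_L /between /rising /falling.
case/orP => [/orP[]|] /andP[/eqP -> /eqP ->] /=; case: (odd i) => /=.
all: move=> x2 x1 x0.
all: try case=> [[y1 y0 y2 x]|[y1 y0 y2 x]].
all: lra.
Qed.

Lemma in_out_planar i k p : (i < n)%N -> (k < 3)%N ->
  on_model F i 0 p -> on_model F i.+1 k p -> p = F i.+1 0%N.
Proof.
move=> iN k3 e e'; apply: pt_eq; move: e e'.
have := layout_star iN; have := layout_x 0 0 iN; have := layout_x 0 0 (ltnW iN).
have := layout_x 0 1 (ltnW iN); have := layout_x 0 2 (ltnW iN).
have {k3}: [|| k == 0%N, k == 1%N | k == 2%N] by lia.
rewrite /on_model /pos /far_end /on_L /between /rising /falling.
case/or3P => /eqP -> /=; case: (odd i) => /=.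
all: move=> x2 x1 x0 x.
all: try case=> [[y1 y0 y2 x']|[y1 y0 y2 x']].
all: lra.
Qed.

End Layout.

Section ModelDrawing.
Variables (n : nat) (F : nat -> nat -> pt).
Hypothesis lF : layout n F.

Lemma model_planar i k j l p : (i < n)%N -> (j < n)%N -> (k < 3)%N -> (l < 3)%N ->
  (i, k) != (j, l) -> on_model F i k p -> on_model F j l p ->
  exists u, [/\ u \in [:: (i, 0%N); far_end i k], u \in [:: (j, 0%N); far_end j l] &
                p = pos F u].
Proof.
wlog ij : i j k l / (i <= j)%N.
  move=> W iN jN k3 l3 ne e e'; have [|/ltnW] := leqP i j => ij; first exact: W.
  by have [|u [? ? ?]] := W j i l k ij jN iN l3 k3 _ e' e; [rewrite eq_sym|exists u].
move=> iN jN k3 l3 ne e e'.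
move: ij; rewrite leq_eqVlt => /predU1P[ij|ij].
  subst j; exists (i, 0%N); rewrite !inE eqxx; split=> //.
  have kl : k != l by apply: contra ne => /eqP ->.
  have [lt|lt|E] := ltngtP k l; last by rewrite E eqxx in kl.
  - exact: (out_edges_planar lF (ltnW iN) lt).
  - exact: (out_edges_planar lF (ltnW iN) lt).
case: j jN ij ne e' => // j jN ij ne e'.
have gt := on_model_gt lF 0 (ltnW jN) e'.
have le := on_model_le lF (ltnW iN) e.
(* If the nodes are not consecutive, [p] would lie both weakly left of spine node [i.+1] and
   strictly right of a node that is [i.+1] or later. *)
move: ij; rewrite ltnS leq_eqVlt => /predU1P[ij|ij]; last first.
  move: ij; rewrite leq_eqVlt => /predU1P[ij|ij].
    by rewrite ij in le; have := lt_le_trans gt le; rewrite ltxx.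
  have := layout_ltx lF 0 0 ij ltac:(lia).
  by move/(le_lt_trans le)/(lt_trans gt); rewrite ltxx.
subst j; have [k0|k0] := eqVneq k 0%N.
  subst k; exists (i.+1, 0%N); rewrite !inE eqxx orbT; split=> //.
  exact: (in_out_planar lF (ltnW jN) l3).
(* A leaf edge ends, in abscissa, at [F i 0] or [F i k], and the edges of the next node lie strictly
   right of both. *)
have := on_leaf_lt lF 0 (ltnW iN) k0 e => lt.
have := on_model_gt lF k (ltnW jN) e'; have := on_model_gt lF 0 (ltnW jN) e'.
move: e; rewrite /on_model /far_end (negPf k0) /pos /= /on_L /between; case: ifP => _; lra.
Qed.

Lemma pos_inj u v : (u.1 <= n)%N -> (v.1 <= n)%N -> (u.2 < 3)%N -> (v.2 < 3)%N ->
  pos F u = pos F v -> u = v.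
Proof.
case: u v => i r [j r'] /= iN jN r3 r'3; rewrite /pos /= => E.
have [ij|ij|ij] := ltngtP i j.
- by have := layout_ltx lF r r' ij (leqW jN); rewrite E ltxx.
- by have := layout_ltx lF r' r ij (leqW iN); rewrite E ltxx.
subst j; congr pair; have := layout_star lF iN.
have [/(congr1 fst) E1 /(congr1 snd) E2] := (E, E); move: E1 E2 {E} => /=.
have : [|| r == 0, r == 1 | r == 2]%N by lia.
have : [|| r' == 0, r' == 1 | r' == 2]%N by lia.
rewrite /rising /falling.
case/or3P => /eqP -> /or3P[] /eqP -> //; case: (odd i).
all: move=> E1 E2.
all: first [by case=> [[y1 y0 y2 x']|[y1 y0 y2 x']]; exfalso; lra | by move=> y; exfalso; lra].
Qed.

(* The position of the edge to node [b] in the counterclockwise order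
   next, leaf 1, previous, leaf 2 around the spine node [a]. *)
Definition code (a b : nat * nat) : nat :=
  (if a.1 < b.1 then 0 else if b.1 < a.1 then 2 else if b.2 == 1 then 1 else 3)%N.

(** Horizontal means even [a.1], except for a leaf edge seen from its spine node, where the parity
    is flipped. *)
Definition horizontal_at (a b : nat * nat) := odd a.1 == (a.2 == 0%N) && (b.2 != 0%N).

Definition bend (a b : nat * nat) : pt :=
  if horizontal_at a b then ((pos F b).1, (pos F a).2) else ((pos F a).1, (pos F b).2).

Definition direction (p c : pt) : nat :=
  if p.1 < c.1 then 0%N else if p.2 < c.2 then 1%N else if c.1 < p.1 then 2%N else 3%N.

Definition model_edge (a b : nat * nat) :=
  [&& a.2 == 0, (a.1 < n) & has (fun k => b == far_end a.1 k) (iota 0 3)]%N.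

Definition model_adj a b := model_edge a b || model_edge b a.

(** The drawing realizes the abstract cyclic order turned by [s] quarter turns: none at an even
    node, one at a rising node, three at a falling node. *)
Lemma direction_code i : (i <= n)%N -> exists2 s, s \in [:: 0; 1; 3]%N &
  forall b, model_adj (i, 0%N) b ->
    direction (F i 0%N) (bend (i, 0%N) b) = ((code (i, 0%N) b + s) %% 4)%N.
Proof.
move=> iN; pose P s b := direction (F i 0%N) (bend (i, 0%N) b) = ((code (i, 0%N) b + s) %% 4)%N.
suff [s s3 [P1 P2 P3 P4]] : exists2 s, s \in [:: 0; 1; 3]%N &
    [/\ P s (i.+1, 0%N), P s (i, 1%N), P s (i, 2%N) & (0 < i)%N -> P s (i.-1, 0%N)].
  exists s => // b /orP[] /and3P[].
    by move=> _ _ /hasP[k + /eqP ->]; rewrite !inE => /or3P[] /eqP ->.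
  case: b => j r /eqP r0 _ /hasP[k + /eqP]; rewrite !inE; move: r0 => /= ->.
  case/or3P => /eqP -> // [ji]; have -> : j = i.-1 by rewrite ji.
  by apply: P4; rewrite ji.
have := layout_star lF iN; have := layout_x lF 0 0 iN.
have : (0 < i)%N -> (F i.-1 0%N).1 < (F i 0%N).1.
  by move=> i0; apply: (layout_ltx lF); lia.
rewrite /P /direction /bend /horizontal_at /code /pos /= !ltnn leqnn /=.
have -> : (i < i.-1)%N = false by lia.
case oi : (odd i) => /=; rewrite !ltxx.
  have i0 : (0 < i)%N by lia.
  have -> : (i.-1 < i)%N by lia.
  move=> _ _ [] [/andP[y1 y1'] /andP[y0 y0'] /andP[y2 y2'] /andP[x x']].
    by exists 1%N => //; rewrite y0' (lt_gtF x) x x' (lt_gtF y0).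
  by exists 3%N => //; rewrite y0' (lt_gtF y0) x' (lt_gtF x) x.
move=> xp x /andP[y y']; exists 0%N => //.
rewrite x y' (lt_gtF y); split=> // i0.
by rewrite (lt_gtF (xp i0)) (xp i0) ltn_predL i0.
Qed.

End ModelDrawing.

(** A strictly increasing list of numbers below 4 is given by four booleans, so with [c] reduced
    modulo 4 there are 64 cases, each settled by computation. *)
Lemma sorted_shift_mod4 (T : eqType) (g h : T -> nat) (c : nat) (s : seq T) :
  {in s, forall x, (g x < 4)%N} -> {in s, forall x, h x = ((g x + c) %% 4)%N} ->
  sorted (fun x y => g x < g y)%N s -> exists k, sorted (fun x y => h x < h y)%N (rot k s).
Proof.
move=> g4 hE gs.
have relE (f : T -> nat) t : sorted (fun x y => f x < f y)%N t = sorted ltn (map f t).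
  by rewrite sorted_map.
have mE : map h s = [seq ((x + c) %% 4)%N | x <- map g s].
  by rewrite -map_comp; apply/eq_in_map => x /hE.
suff [k k4] : exists k, sorted ltn (rot k (map h s)) by exists k; rewrite relE map_rot.
rewrite {h hE}mE -(@eq_map _ _ (fun x => ((x + c %% 4) %% 4)%N)); last first.
  by move=> x /=; rewrite modnDmr.
have sE : map g s = filter (mem (map g s)) (iota 0 4).
  apply: (irr_sorted_eq ltn_trans ltnn); first by rewrite -relE.
    by apply: sorted_filter; [exact: ltn_trans|exact: iota_ltn_sorted].
  move=> x; rewrite mem_filter mem_iota /= andb_idr // => /mapP[y /g4 y4 ->].
  by rewrite add0n.
suff /hasP[k _ kP] : has (fun k => sorted ltn (rot k [seq ((x + c %% 4) %% 4)%N | x <- map g s])) (iota 0 4).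
  by exists k.
have filterE (Q : pred nat) : filter Q (iota 0 4) =
    nseq (Q 0%N) 0%N ++ nseq (Q 1%N) 1%N ++ nseq (Q 2%N) 2%N ++ nseq (Q 3%N) 3%N.
  by rewrite /=; case: (Q 0%N); case: (Q 1%N); case: (Q 2%N); case: (Q 3%N).
have [b0 [b1 [b2 [b3 ->]]]] : exists b0 b1 b2 b3 : bool,
    map g s = nseq b0 0%N ++ nseq b1 1%N ++ nseq b2 2%N ++ nseq b3 3%N.
  by rewrite sE filterE; do 4!eexists.
have : (c %% 4 < 4)%N by rewrite ltn_mod.
case: (c %% 4)%N => [|[|[|[|]]]] // _.
all: by case: b0; case: b1; case: b2; case: b3.
Qed.

Lemma code_lt a b : (code a b < 4)%N.
Proof. by rewrite /code; do !case: ifP => // _. Qed.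

(** * Transferring the model drawing to a graph *)

Section Drawing.
Variables (V : finType) (adj : rel V) (rho : V -> seq V) (P : seq pt).
Variables (n : nat) (F : nat -> nat -> pt) (phi : V -> nat * nat).
Hypothesis lF : layout n F.
Hypothesis FP : forall i r, (i <= n)%N -> F i r \in P.
Hypothesis phi_inj : injective phi.
Hypothesis phi_lt : forall v, ((phi v).1 < n)%N && ((phi v).2 < 3)%N.
Hypothesis phi_adj : forall u v, adj u v -> model_adj n (phi u) (phi v).

Lemma far_horizontal i k : horizontal_at (i, 0%N) (far_end i k) = (odd i == (k != 0%N)).
Proof. by rewrite /horizontal_at /far_end; have [_|k0] := eqVneq k 0%N; rewrite //= k0. Qed.

Lemma horizontal_far i k : horizontal_at (far_end i k) (i, 0%N) = (odd i != (k != 0%N)).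
Proof. 
rewrite /horizontal_at /far_end; have [_|/negPf k0] := eqVneq k 0%N => /=.
  by case: (odd i).
by rewrite k0; case: (odd i). Qed.

Lemma bendC a b : model_adj n a b -> bend F a b = bend F b a.
Proof.
suff W x y : model_edge n x y -> bend F x y = bend F y x by case/orP => /W // ->.
case: x => i r /and3P[/eqP r0 _ /hasP[k _ /eqP ->]]; move: r0 => /= ->.
by rewrite /bend far_horizontal horizontal_far; case: eqP.
Qed.

Definition place v := pos F (phi v).
Definition corner u v := bend F (phi u) (phi v).

Lemma on_edge_model u v : adj u v -> exists i k, [/\ (i < n)%N, (k < 3)%N,
  (phi u = (i, 0%N) /\ phi v = far_end i k) \/ (phi v = (i, 0%N) /\ phi u = far_end i k) &
  forall p, on_edge place corner u v p -> on_model F i k p].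
Proof.
have W x y : model_edge n (phi x) (phi y) -> exists i k, [/\ (i < n)%N, (k < 3)%N,
    phi x = (i, 0%N) /\ phi y = far_end i k &
    forall p, on_edge place corner x y p -> on_model F i k p].
  rewrite /on_edge /place /corner; case: (phi x) => i r.
  case/and3P => /eqP r0 iN /hasP[k]; rewrite mem_iota add0n.
  move: r0 => /= -> k3 /eqP ->.
  exists i, k; split=> // p; rewrite /on_model /bend far_horizontal -negb_eqb.
  case: eqP => _ /= [].
  - exact: on_L_horizontal.
  - exact: on_L_vertical.
  - by move/on_segC; apply: on_L_vertical.
  - by move/on_segC; apply: on_L_horizontal.
move=> /phi_adj uv; have cE := bendC uv; case/orP: uv => /W [i [k [iN k3 E H]]].
  by exists i, k; split=> //; left.
exists i, k; split=> //; first by right.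
by move=> p [] /on_segC e; apply: H; [right|left]; rewrite /corner -cE.
Qed.

(** What remains to be found is combinatorial: a numbering [phi] of the vertices by nodes. A vertex
    with at most one neighbour imposes no order; any other must be a spine node whose prescribed
    order agrees with [code] up to rotation. *)
Lemma layout_drawing :
  (forall v, {subset rho v <= adj v}) ->
  (forall v, (size (rho v) <= 1)%N \/ ((phi v).2 = 0%N /\ exists k,
     sorted (fun a b => code (phi v) (phi a) < code (phi v) (phi b))%N (rot k (rho v)))) ->
  planar_L_drawing adj rho P.
Proof.
move=> rho_adj rho_code; exists place, corner; split.
- split.
  + move=> u v /(pos_inj lF); have /andP[u1 u2] := phi_lt u; have /andP[v1 v2] := phi_lt v.
    by move=> E; apply/phi_inj/E => //; apply: ltnW.
  + by move=> v; apply: FP; have /andP[/ltnW] := phi_lt v.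
  + move=> u v /phi_adj uv; split; first exact: bendC.
    by rewrite /corner /bend; case: ifP; [right|left].
- move=> u v u' v' /on_edge_model[i [k [iN k3 E H]]] /on_edge_model[j [l [jN l3 E' H']]].
  move=> ne p /H e /H' e'.
  (* The pair of node and edge number determines both ends, and [phi] is injective. *)
  have ne' : (i, k) != (j, l).
    apply: contra ne => /eqP [? ?]; subst j l; apply/eqP.
    case: E E' => -[E1 E2] [] [E3 E4]; rewrite -?E3 -?E4 in E1 E2.
    - by rewrite (phi_inj E1) (phi_inj E2).
    - by rewrite (phi_inj E1) (phi_inj E2) setUC.
    - by rewrite (phi_inj E1) (phi_inj E2) setUC.
    - by rewrite (phi_inj E1) (phi_inj E2).
  have [x [xi xj ->]] := model_planar lF iN jN k3 l3 ne' e e'.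
  have Eu : x \in [:: phi u; phi v].
    by move: xi; case: E => -[-> ->]; rewrite !inE // orbC.
  have Eu' : x \in [:: phi u'; phi v'].
    by move: xj; case: E' => -[-> ->]; rewrite !inE // orbC.
  have [w wE] : exists w, x = phi w.
    by move: Eu; rewrite !inE => /orP[] /eqP ->; eexists.
  exists w; move: Eu Eu'; rewrite !inE wE !(inj_eq phi_inj) => -> ->.
  by split.
- move=> v; have [s1|[v0 [k sk]]] := rho_code v.
    by exists 0%N; rewrite rot0; case: (rho v) s1 => [|x []].
  have iN : ((phi v).1 <= n)%N by have /andP[/ltnW] := phi_lt v.
  have [c _ cP] := direction_code lF iN.
  have vE : phi v = ((phi v).1, 0%N) by rewrite -v0; case: (phi v).
  rewrite -vE in cP.
  have [|x|l lP] := @sorted_shift_mod4 _ (fun w => code (phi v) (phi w)) (dir place corner v) c _ _ _ sk.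
  + by move=> x _; exact: code_lt.
  + by rewrite mem_rot => /rho_adj /phi_adj vx; rewrite -cP // /dir /direction /place /pos v0.
  + by move: lP; rewrite rot_rot_add; eexists; exact: lP.
Qed.

End Drawing.

(** * Structure of top-view caterpillars *)

Lemma sum_succ m : (\sum_(i < m) \sum_(j < m) (j == i.+1 :> nat) = m.-1)%N.
Proof.
have sum1 k p : (\sum_(j < p) (j == k :> nat) = (k < p))%N.
  elim: p => [|p IHp]; first by rewrite big_ord0.
  by rewrite big_ord_recr IHp /=; case: (ltngtP k p) => //; lia.
under eq_bigr do rewrite sum1.
case: m => [|m]; first by rewrite big_ord0.
rewrite big_ord_recr /= ltnn addn0 -[RHS]card_ord -sum1_card.
by apply: eq_bigr => i _; rewrite ltnS ltn_ord.
Qed.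

Section TopView.
Variables (V : finType) (adj : rel V) (rho : V -> seq V).
Hypothesis tv : top_view_caterpillar adj rho.
Local Open Scope nat_scope.

Lemma adjC : symmetric adj.
Proof. by case: tv => -[[[]]]. Qed.

Lemma adj_irr : irreflexive adj.
Proof. by case: tv => -[[[]]]. Qed.

Lemma degE v : deg adj v = \sum_w adj v w.
Proof. by rewrite /deg cardsE -sum1_card big_mkcond. Qed.

Lemma sum_degree : \sum_v \sum_w adj v w = 2 * (#|V| - 1).
Proof.
case: tv => -[[_ _ <-] _] _ _; rewrite pair_big /= cardsE -sum1_card [RHS]big_mkcond /=.
by apply: eq_bigr => -[x y] _; rewrite unfold_in /=; case: (adj x y).
Qed.

Lemma size_rho v : size (rho v) = deg adj v.
Proof.
case: tv => _ /(_ v)[u m] _; rewrite /deg cardsE -(card_uniqP u).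
by apply: eq_card => w; rewrite m.
Qed.

Lemma leaf_unique v w w' : leaf adj v -> adj v w -> adj v w' -> w = w'.
Proof.
rewrite /leaf /deg => /cards1P[x E] aw aw'.
by have := in_set1 w x; have := in_set1 w' x; rewrite -E !inE aw aw' => /esym/eqP -> /esym/eqP ->.
Qed.

(** The pair is closed under adjacency, hence is the whole tree by connectedness. *)
Lemma leaf_edge u v : leaf adj u -> leaf adj v -> adj u v -> forall w, (w == u) || (w == v).
Proof.
move=> lu lv uv w; case: tv => -[[_ con _] _] _ _.
have cl : closed adj (pred2 u v).
  move=> x y xy; have yx : adj y x by rewrite adjC.
  have vu : adj v u by rewrite adjC.
  apply/idP/idP; rewrite !inE => /orP[] /eqP E; subst.
  - by rewrite (leaf_unique lu xy uv) eqxx orbT.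
  - by rewrite (leaf_unique lv xy vu) eqxx.
  - by rewrite (leaf_unique lu yx uv) eqxx orbT.
  - by rewrite (leaf_unique lv yx vu) eqxx.
by have := closed_connect cl (con u w); rewrite !inE eqxx /= => /esym.
Qed.

Lemma spine_leaf_count v : spine_vertex adj v ->
  \sum_(w | leaf adj w) adj v w = 2.
Proof.
case: tv => _ _ H /H[<- _]; rewrite cardsE -sum1_card big_mkcond /= [RHS]big_mkcond /=.
by apply: eq_bigr => w _; rewrite ?inE ?unfold_in /=; case: (leaf adj w); case: (adj v w).
Qed.

Section Spine.
Variable s : seq V.
Hypotheses (us : uniq s) (sE : forall v, (v \in s) = spine_vertex adj v).
Hypotheses (ss : sorted adj s) (s0 : s != [::]).

Lemma spine_leafE v : leaf adj v = (v \notin s).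
Proof. by rewrite sE /spine_vertex negbK. Qed.

Lemma leaf_nbr_spine v w : leaf adj v -> adj v w -> w \in s.
Proof.
move=> lv vw; apply: contraT; rewrite -spine_leafE => lw.
have /hasP[x xs _] : has predT s by rewrite has_predT lt0n size_eq0.
have := leaf_edge lv lw vw x => /orP[] /eqP E; move: xs; rewrite E sE /spine_vertex.
  by rewrite lv.
by rewrite lw.
Qed.

Lemma card_spine : \sum_(v in s) 1 = size s.
Proof. by rewrite sum1_card (card_uniqP us). Qed.

(** Double counting of the edges between leaves and spine: one at each leaf, two at each spine
    vertex. *)
Lemma count_leaves : \sum_(w | leaf adj w) 1 = 2 * size s.
Proof.
transitivity (\sum_(w | leaf adj w) \sum_(v in s) adj v w).
  apply: eq_bigr => w lw.
  have -> : 1 = deg adj w by have /eqP -> := lw.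
  rewrite degE (bigID (mem s)) /= [X in _ + X]big1 ?addn0; last first.
    by move=> v; apply: contraNeq; rewrite eqb0 negbK; apply: leaf_nbr_spine.
  by apply: eq_bigr => v _; rewrite adjC.
rewrite exchange_big /= -card_spine big_distrr /=.
by apply: eq_bigr => v; rewrite sE => /spine_leaf_count ->.
Qed.

Lemma card_caterpillar : #|V| = 3 * size s.
Proof.
rewrite -sum1_card (bigID (mem s)) /= card_spine.
have -> : \sum_(i | i \notin s) 1 = 2 * size s.
  by rewrite -count_leaves; apply: eq_bigl => v; rewrite spine_leafE.
lia.
Qed.

(** With [m] spine vertices the tree has degree sum [2 * (3 * m - 1)]; the leaf edges contribute
    [2 * m] at their leaves and [2 * m] at the spine. *)
Lemma spine_edge_count : \sum_(v in s) \sum_(w in s) adj v w = 2 * (size s).-1.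
Proof.
have := sum_degree; rewrite (bigID (mem s)) /=.
have -> : \sum_(v | v \notin s) \sum_w adj v w = 2 * size s.
  rewrite -count_leaves; apply: eq_big => v; first by rewrite spine_leafE.
  by rewrite -spine_leafE -degE => /eqP.
have -> : \sum_(v in s) \sum_w adj v w =
    \sum_(v in s) \sum_(w in s) adj v w + 2 * size s.
  rewrite -card_spine big_distrr -big_split /=; apply: eq_bigr => v vs.
  rewrite (bigID (mem s)) /= muln1; congr (_ + _).
  rewrite -[RHS](spine_leaf_count (v := v)) -?sE //.
  by apply: eq_bigl => w; rewrite spine_leafE.
rewrite card_caterpillar; have : 0 < size s by rewrite lt0n size_eq0.
by move: (\sum_(v in s) _) => A; lia.
Qed.

Lemma spine_consecutive x0 i : i.+1 < size s -> adj (nth x0 s i) (nth x0 s i.+1).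
Proof. by move=> iS; move/(sortedP x0): ss; apply. Qed.

(* The 2 (m - 1) pairs of consecutive spine vertices exhaust the spine edges. *)
Lemma spine_adj v w : v \in s -> w \in s -> adj v w ->
  (index w s == (index v s).+1) || (index v s == (index w s).+1).
Proof.
pose c v w := (index w s == (index v s).+1) || (index v s == (index w s).+1).
have cadj v' w' : v' \in s -> w' \in s -> c v' w' -> adj v' w'.
  have W x y : x \in s -> y \in s -> index y s == (index x s).+1 -> adj x y.
    move=> xs ys /eqP E; have := spine_consecutive x (i := index x s).
    by rewrite -E index_mem !nth_index //; apply.
  by move=> vs ws /orP[]; [|rewrite adjC]; apply: W.
have le v' w' : v' \in s -> w' \in s -> c v' w' <= adj v' w' ?= iff (c v' w' == adj v' w').
  move=> vs ws; split; last by case: (c v' w'); case: (adj v' w').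
  by have := cadj v' w' vs ws; case: (c v' w') => // ->.
have csum : \sum_(v in s) \sum_(w in s) c v w = 2 * (size s).-1.
  have byi (G : V -> nat) : \sum_(v in s) G v = \sum_(i < size s) G (nth v s i).
    by rewrite -big_uniq //= (big_nth v) big_mkord.
  rewrite byi mul2n -addnn -{1}(sum_succ (size s)) -(sum_succ (size s)).
  rewrite [X in _ = _ + X]exchange_big -big_split /=; apply: eq_bigr => i _.
  rewrite byi -big_split /=; apply: eq_bigr => j _.
  by rewrite /c !index_uniq //; case: eqP; case: eqP => //; lia.
move=> vs ws vw.
have [_] := leqif_sum (fun v' vs => leqif_sum (fun w' ws => le v' w' vs ws)).
rewrite csum spine_edge_count eqxx => /esym/forall_inP/(_ v vs)/forall_inP/(_ w ws)/eqP.
by rewrite vw.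
Qed.

(** This anticipates the value of [code] when [a] is made leaf 1 of [v]. The numbering depends on
    that choice, so the choice is settled first. *)
Definition slot a v w :=
  if w \in s then if index v s < index w s then 0 else 2 else if w == a then 1 else 3.

Lemma slot_inj a v w w' : v \in s -> w \in s -> w' \in s -> adj v w -> adj v w' ->
  slot a v w = slot a v w' -> w = w'.
Proof.
move=> vs ws ws' vw vw'; rewrite /slot ws ws'.
have := spine_adj vs ws vw; have := spine_adj vs ws' vw' => iw' iw E.
rewrite -(nth_index v ws) -(nth_index v ws'); congr nth.
by move: E; case: ifP => h1; case: ifP => h2; lia.
Qed.

Lemma two_leaves v : v \in s -> exists l l', [/\ l != l', adj v l && leaf adj l,
  adj v l' && leaf adj l' & forall w, adj v w -> leaf adj w -> (w == l) || (w == l')].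
Proof.
rewrite sE => vs; case: tv => _ _ /(_ v vs)[/eqP + _].
case/cards2P => l [l' [ll E]].
have mE w : (adj v w && leaf adj w) = (w == l) || (w == l').
  by have := in_set2 w l l'; rewrite -E inE.
by exists l, l'; split=> //; rewrite ?mE ?eqxx ?orbT // => w vw lw; rewrite -mE vw.
Qed.

(** Cut open at one leaf, the cyclic order reads [l], [t1], [l'], [t2] with at most one spine
    neighbour in each arc. Leaf 1 is then the leaf that follows the next spine vertex, or precedes
    the previous one. *)
Lemma spine_rotation v : v \in s -> exists a, [/\ adj v a, leaf adj a &
  exists k, sorted (fun x y => slot a v x < slot a v y) (rot k (rho v))].
Proof.
move=> vs; have [l [l' [ll /andP[vl ll1] /andP[vl' ll1'] only]]] := two_leaves vs.
have [ur mr] : uniq (rho v) /\ (forall w, (w \in rho v) = adj v w).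
  by case: tv => _ /(_ v).
have lr : l \in rho v by rewrite mr.
have := rot_index lr; set i := index l _; move: (_ ++ _) => t rE.
have mE w : (w \in l :: t) = adj v w by rewrite -rE mem_rot mr.
have ut : uniq (l :: t) by rewrite -rE rot_uniq.
have l't : l' \in t by have := mE l'; rewrite inE eq_sym (negPf ll) vl'.
case/path.splitPr: l't rE mE ut => t1 t2 rE mE ut.
have [nl nl' utt] : [/\ l \notin t1 ++ t2, l' \notin t1 ++ t2 & uniq (t1 ++ t2)].
  move: ut; rewrite cons_uniq -(cat1s l' t2) uniq_catCA cons_uniq => /and3P[n n' u].
  by split=> //; move: n; rewrite !mem_cat !negb_or => /and3P[-> _ ->].
have ts w : w \in t1 ++ t2 -> (w \in s) && adj v w.
  move=> wt; have vw : adj v w.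
    by rewrite -mE; move: wt; rewrite !(inE, mem_cat) => /orP[] ->; rewrite ?orbT.
  rewrite vw andbT; apply: contraT; rewrite -spine_leafE => lw.
  by case/orP: (only w vw lw) => /eqP E; [move: nl|move: nl']; rewrite -E wt.
have sz2 : size (t1 ++ t2) <= 2.
  rewrite -(size_map (slot l v)); apply: (@uniq_leq_size _ _ [:: 0; 2]).
    by rewrite map_inj_in_uniq // => x y /ts /andP[xs vx] /ts /andP[ys vy]; apply: slot_inj.
  by move=> _ /mapP[x /ts /andP[xs _] ->]; rewrite /slot xs; case: ifP.
have inj : {in t1 ++ t2 &, injective (slot l v)}.
  by move=> x y /ts /andP[xs vx] /ts /andP[ys vy]; apply: slot_inj.
have ls : l \notin s by rewrite -spine_leafE.
have ls' : l' \notin s by rewrite -spine_leafE.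
have card_nbr : #|[set w | adj v w & spine_vertex adj w]| = size (t1 ++ t2).
  rewrite -(card_uniqP utt); apply: eq_card => w; rewrite inE -sE; apply/andP/idP.
    move=> [+ ws]; rewrite -mE !(inE, mem_cat).
    have /negPf -> : w != l by apply: contraNneq ls => <-.
    by have /negPf -> : w != l' by apply: contraNneq ls' => <-.
  by move=> /ts /andP[].
(* Two spine neighbours are split between the arcs by the separation hypothesis; with fewer, the
   total size is enough. *)
have [sz1 sz1'] : size t1 <= 1 /\ size t2 <= 1.
  move: card_nbr sz2; rewrite size_cat => card_nbr.
  rewrite leq_eqVlt => /predU1P[sz|]; last first.
    by move: (size t1) (size t2) => [|[|p]] [|[|q]] //; rewrite ?addnS.
  case: tv => _ _ /(_ v); rewrite -sE card_nbr sz => /(_ vs)[_ /(_ erefl l l' ll vl ll1 vl' ll1')].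
  have il : index l' (l :: t1 ++ l' :: t2) = (size t1).+1.
    by move: nl'; rewrite /= (negPf ll) mem_cat index_cat negb_or => /andP[/negPf -> _] /=; rewrite eqxx addn0.
  rewrite /separated -/i rE il /= take_size_cat // drop0 -addn1 addnC -drop_drop drop_size_cat //= drop0.
  case/andP; rewrite !has_count => /leq_trans/(_ (count_size _ _)) h1.
  move=> /leq_trans/(_ (count_size _ _)); move: sz h1.
  by move: (size t1) (size t2) => [|[|p]] [|[|q]]; rewrite ?addnS.
have fin a : adj v a -> leaf adj a ->
    (exists k, sorted (fun x y => slot a v x < slot a v y) (rot k (l :: t1 ++ l' :: t2))) ->
    exists a, [/\ adj v a, leaf adj a &
      exists k, sorted (fun x y => slot a v x < slot a v y) (rot k (rho v))].
  by move=> va la [k]; rewrite -rE rot_rot_add => st; exists a; split=> //; eexists; exact: st.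
have sl : slot l v l = 1 by rewrite /slot (negPf ls) eqxx.
have sl' : slot l v l' = 3 by rewrite /slot (negPf ls') eq_sym (negPf ll).
have s'l : slot l' v l = 3 by rewrite /slot (negPf ls) (negPf ll).
have s'l' : slot l' v l' = 1 by rewrite /slot (negPf ls') eqxx.
have ss0 w : w \in t1 ++ t2 -> (slot l v w = 0 /\ slot l' v w = 0) \/
    (slot l v w = 2 /\ slot l' v w = 2).
  by move=> /ts /andP[ws _]; rewrite /slot ws; case: ifP; [left|right].
case: t1 t2 sz1 sz1' {mE ut ts sz2 rE nl nl' card_nbr} fin ss0 inj utt => [|x []] // [|z []] // _ _ fin ss0 inj utt.
(* In every case the rotation brings the smallest slot to the front. *)
- by apply: (fin l) => //; exists 0; rewrite /= sl sl'.
- case: (ss0 z); rewrite ?inE ?eqxx // => -[z1 z2].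
  + by apply: (fin l) => //; exists 2; rewrite /= sl sl' z1.
  + by apply: (fin l') => //; exists 1; rewrite /= s'l s'l' z2.
- case: (ss0 x); rewrite ?inE ?eqxx // => -[x1 x2].
  + by apply: (fin l') => //; exists 1; rewrite /= s'l s'l' x2.
  + by apply: (fin l) => //; exists 0; rewrite /= sl sl' x1.
- have xz : slot l v x <> slot l v z.
    by move/inj; rewrite !inE !eqxx orbT => /(_ isT isT) E; move: utt; rewrite /= inE E eqxx.
  case: (ss0 x); case: (ss0 z); rewrite ?inE ?eqxx ?orbT // => -[z1 z2] [x1 x2].
  + by case: xz; rewrite x1 z1.
  + by apply: (fin l') => //; exists 1; rewrite /= s'l s'l' x2 z2.
  + by apply: (fin l) => //; exists 3; rewrite /= sl sl' x1 z1.
  + by case: xz; rewrite x1 z1.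
Qed.

Lemma spine_nodes : exists phi : V -> nat * nat, [/\ injective phi,
  forall v, ((phi v).1 < #|V|) && ((phi v).2 < 3),
  forall u v, adj u v -> model_adj #|V| (phi u) (phi v) &
  forall v, size (rho v) <= 1 \/ (phi v).2 = 0%N /\ exists k,
    sorted (fun x y => code (phi v) (phi x) < code (phi v) (phi y)) (rot k (rho v))].
Proof.
(* Choice functions: [a] gives leaf 1 of a spine vertex, [b] the neighbour of a leaf; elsewhere
   their values are dummies. *)
have /fin_all_exists[a aP] : forall v, exists a, v \in s -> [/\ adj v a, leaf adj a &
    exists k, sorted (fun x y => slot a v x < slot a v y) (rot k (rho v))].
  move=> v; have [/spine_rotation[a aP]|] := boolP (v \in s); first by exists a.
  by exists v.
have /fin_all_exists[b bP] : forall v, exists b, leaf adj v -> adj v b.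
  move=> v; have [|] := boolP (leaf adj v); last by exists v.
  rewrite /leaf /deg => /cards1P[b E]; exists b => _.
  by have := set11 b; rewrite -E inE.
have bE v w : v \notin s -> adj v w -> b v = w.
  by rewrite -spine_leafE => lv vw; apply: (leaf_unique lv (bP _ lv)).
have bs v : v \notin s -> b v \in s.
  by rewrite -spine_leafE => lv; apply: leaf_nbr_spine (bP _ lv).
pose phi w := if w \in s then (index w s, 0) else (index (b w) s, if w == a (b w) then 1 else 2).
have iV v : v \in s -> index v s < #|V|.
  by rewrite -index_mem card_caterpillar => /leq_trans; apply; rewrite leq_pmull.
exists phi; split.
- have idx x y : x \in s -> y \in s -> index x s = index y s -> x = y.
    by move=> xs ys E; rewrite -(nth_index x xs) -(nth_index x ys) E.
  move=> x y; rewrite /phi; case xs: (x \in s); case ys: (y \in s); last 1 first.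
  + case=> /(idx _ _ (bs _ (negbT xs)) (bs _ (negbT ys))) E; rewrite -E.
    have [xa|xa] := eqVneq x (a (b x)); first by case: eqP => // ya _; rewrite ya.
    (* Neither leaf is the chosen one, and their common spine vertex has just two leaves, so they
       coincide. *)
    case: eqP => // /eqP ya _.
    have [l [l' [ll _ _ only]]] := two_leaves (bs _ (negbT xs)).
    have [/only aa /aa {}aa _] := aP _ (bs _ (negbT xs)).
    have lx : leaf adj x by rewrite spine_leafE xs.
    have ly : leaf adj y by rewrite spine_leafE ys.
    have /only/(_ lx) xl : adj (b x) x by rewrite adjC bP.
    have /only/(_ ly) yl : adj (b x) y by rewrite adjC E bP.
    move: xa ya; case/orP: aa => /eqP ->; case/orP: xl => /eqP ->;
      by case/orP: yl => /eqP ->; rewrite ?eqxx.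
  + by case=> /idx; apply.
  + by case; case: ifP.
  + by case=> _; case: ifP.
- move=> v; rewrite /phi; case: ifP => vs /=; rewrite iV ?bs ?vs //.
  by case: ifP.
- have up x y : x \in s -> y \notin s -> adj x y -> model_edge #|V| (phi x) (phi y).
    move=> xs ys xy; rewrite /phi xs (negPf ys) (bE y x ys) 1?adjC // /model_edge /= iV //=.
    by case: ifP; rewrite /far_end /= !xpair_eqE !eqxx ?orbT.
  have next x y : x \in s -> y \in s -> index y s == (index x s).+1 ->
      model_edge #|V| (phi x) (phi y).
    by move=> xs ys /eqP E; rewrite /phi xs ys /model_edge /= iV // E /far_end /= eqxx.
  move=> u v uv; rewrite /model_adj; have vu : adj v u by rewrite adjC.
  case us' : (u \in s); case vs : (v \in s).
  + by case/orP: (spine_adj us' vs uv) => /next -> //; rewrite ?orbT.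
  + by rewrite up ?vs.
  + by rewrite (up v u) ?us' ?orbT.
  + by have := leaf_nbr_spine _ uv; rewrite vs spine_leafE us' => /(_ isT).
- move=> v; case vs : (v \in s); last first.
    by left; rewrite size_rho; have /eqP -> : leaf adj v by rewrite spine_leafE vs.
  right; rewrite {1}/phi vs; split=> //; have [_ _ [k sk]] := aP v vs; exists k.
  apply: (@sub_in_sorted _ (adj v)) sk; last first.
    by apply/allP => w; rewrite mem_rot; case: tv => _ /(_ v)[_ ->].
  have codeE w : adj v w -> code (phi v) (phi w) = slot (a v) v w.
    move=> vw; rewrite /code /slot /phi vs; case ws: (w \in s) => /=.
      by have := spine_adj vs ws vw; case: ltngtP => // ->; rewrite orbb ltn_eqF.
    have -> : b w = v by apply: bE; rewrite ?ws // adjC.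
    by rewrite ltnn; case: (w == a v).
  by move=> x y vx vy; rewrite !codeE.
Qed.

End Spine.

(** If the spine is empty, the tree is a single edge; one end is then numbered as a spine node and
    the other as its leaf 1. *)
Lemma top_view_nodes : 0 < #|V| -> exists phi : V -> nat * nat, [/\ injective phi,
  forall v, ((phi v).1 < #|V|) && ((phi v).2 < 3),
  forall u v, adj u v -> model_adj #|V| (phi u) (phi v) &
  forall v, size (rho v) <= 1 \/ (phi v).2 = 0%N /\ exists k,
    sorted (fun x y => code (phi v) (phi x) < code (phi v) (phi y)) (rot k (rho v))].
Proof.
move=> V0; case: (tv) => -[_ [s [us sE ss]]] _ _.
have [s0|s0] := eqVneq s [::]; last exact: spine_nodes us sE ss s0.
have lf v : leaf adj v by have := sE v; rewrite s0 => /esym/negbFE.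
have /card_gt0P[u _] := V0.
have /cards1P[b E] := lf u; have ub : adj u b by have := set11 b; rewrite -E inE.
have ubP := leaf_edge (lf u) (lf b) ub.
exists (fun w => (0, (w != u) : nat)); split.
- move=> x y; case/orP: (ubP x) => /eqP ->; case/orP: (ubP y) => /eqP -> //; rewrite eqxx.
    by case: eqP => // ->.
  by case: eqP => // ->.
- by move=> v; rewrite V0; case: eqP.
- move=> x y xy; rewrite /model_adj /model_edge /= V0.
  have xy' : x != y by apply: contraTneq xy => ->; rewrite adj_irr.
  have bu : b != u by apply: contraTneq ub => ->; rewrite adj_irr.
  move: xy'; case/orP: (ubP x) => /eqP ->; case/orP: (ubP y) => /eqP ->; rewrite ?eqxx //= bu //.
- by move=> v; left; rewrite size_rho; have /eqP -> := lf v.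
Qed.

End TopView.

(** * The constant and the conclusion *)

Lemma ln_gt_half (n : nat) : (2 <= n)%N -> 1 / 2 < ln n%:R :> R.
Proof.
move=> n2; have ln2 : 1 / 2 < ln 2%:R :> R.
  by move/RltP: Rpower.ln_lt_2; rewrite !RealsE /= div1r.
move: n2; rewrite leq_eqVlt => /predU1P[<- //|n2]; apply: lt_trans ln2 _.
by apply/RltP/Rpower.ln_increasing; apply/RltP; rewrite ?RealsE ?ltr_nat ?ltr0n.
Qed.

Theorem theorem2 :
  exists c : R, 0 < c /\
    forall n : nat, (2 <= n)%N ->
    forall (adj : rel 'I_n) (rho : 'I_n -> seq 'I_n),
      top_view_caterpillar adj rho ->
    forall P : seq pt, general_orthogonal P ->
      c * n%:R * ln n%:R <= (size P)%:R ->
      planar_L_drawing adj rho P.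
Proof.
(* Since [ln n] exceeds 1/2, there are at least [50 * n] points, which covers the [3 * (n * 16 + 1)]
   points of the layout for [n] at least 2. *)
exists 100%:R; split; first by rewrite ltr0n.
move=> n n2 adj rho tv P gP szP.
have size_P : (50 * n <= size P)%N.
  rewrite -(ler_nat R); apply: le_trans szP; rewrite natrM.
  have := ln_gt_half n2; have : (0 : R) < n%:R by rewrite ltr0n ltnW.
  nra.
have [|F lF FP] := @layout_exists P gP n (ltnW n2); first by lia.
have [|phi [phi_inj phi_lt phi_adj phi_rot]] := top_view_nodes tv.
  by rewrite card_ord ltnW.
rewrite card_ord in phi_lt phi_adj.
apply: (layout_drawing lF FP phi_inj phi_lt phi_adj _ phi_rot).
by move=> v w; case: tv => _ /(_ v)[_ ->].
Qed.
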